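(* Let $\mathfrak{G}=\langle\mathbb{N},\leqslant\rangle$ and let $L$ be a superintuitionistic predicate logic such that $\mathsf{QSIL}^{e}\,\mathfrak{G}\subseteq L\subseteq \mathsf{QSIL}(\mathfrak{G}\odot\mathbb{N})$. Then the fragment of the positive fragment $L^+$ of $L$ consisting of its formulas in the language with two individual variables, a single binary predicate letter, and infinitely many unary predicate letters is both $\Sigma^0_1$-hard and $\Pi^0_1$-hard.
   Context: Language: $\mathcal{L}$ is the predicate language (no equality, no function symbols or constants) with countably many individual variables, countably many predicate letters of every arity (nullary ones are proposition letters), $\bot$, $\wedge,\vee,\to$, $\forall,\exists$; $\neg\varphi$ abbreviates $\varphi\to\bot$. A formula is positive if it contains no occurrence of $\bot$; for a logic $L$, $L^+$ is the set of positive formulas in $L$. Semantics: a Kripke frame is $\mathfrak{F}=\langle W,R\rangle$ with $W\neq\varnothing$ and $R$ a partial order on $W$ (only such intuitionistic frames are considered). An augmented frame over $\mathfrak{F}$ is $\mathfrak{F}_D=\langle W,R,D\rangle$ where $D$ assigns to each $w\in W$ a non-empty set $D_w$ with $D_u\subseteq D_w$ whenever $uRw$. $\mathfrak{F}\odot\mathcal{D}$ denotes the augmented frame over $\mathfrak{F}$ with $D_w=\mathcal{D}$ for all $w$. A model over $\mathfrak{F}_D$ has an interpretation $I$ with $I(w,P)\subseteq D_w^n$ for each $n$-ary letter $P$ and $I(w,P)\subseteq I(w',P)$ whenever $wRw'$. Truth at $w$: atoms according to $I(w,\cdot)$; $\bot$ never true; $\wedge,\vee$ pointwise; $\varphi\to\psi$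 is true at $w$ iff for every $v$ with $wRv$, truth of $\varphi$ at $v$ implies truth of $\psi$ at $v$; $\forall x\,\varphi$ is true at $w$ iff for every $v$ with $wRv$ and every $a\in D_v$, $\varphi(a)$ is true at $v$; $\exists x\,\varphi$ is true at $w$ iff $\varphi(a)$ is true at $w$ for some $a\in D_w$. A formula is valid on $\mathfrak{F}_D$ if it is true at every world $w$ of every model over $\mathfrak{F}_D$ under every assignment of elements of $D_w$ to its free variables. $\mathsf{QSIL}(\mathfrak{F}_D)$ is the set of $\mathcal{L}$-formulas valid on $\mathfrak{F}_D$, and $\mathsf{QSIL}^{e}\,\mathfrak{F}$ is the set of $\mathcal{L}$-formulas valid on all augmented frames over $\mathfrak{F}$. Logics: $\mathbf{QInt}$ is the set of $\mathcal{L}$-formulas valid on every augmented frame over every (intuitionistic) Kripke frame. A superintuitionistic predicate logic is a set of $\mathcal{L}$-formulas including $\mathbf{QInt}$ and closed under Modus Ponens, Substitution (of formulas for predicate letters), and Generalization. Hardness is with respect to computable many-one reductions. *)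

(* Defs.v *)
From Stdlib Require List.
From mathcomp Require Import all_boot.

Set Implicit Arguments.
Unset Strict Implicit.
Unset Printing Implicit Defensive.

(** * Formulas *)

(* [Atom i xs] is the letter with index [i] and arity [size xs], applied to the
   variables [xs]: letters of different arities with the same index are
   different letters. *)
Inductive form : Type :=
| Bot
| Atom (i : nat) (xs : seq nat)
| And (phi psi : form)
| Or (phi psi : form)
| Imp (phi psi : form)
| All (x : nat) (phi : form)
| Ex (x : nat) (phi : form).

Fixpoint fv (phi : form) : seq nat :=
  match phi with
  | Bot => [::]
  | Atom _ xs => xs
  | And phi psi | Or phi psi | Imp phi psi => fv phi ++ fv psi
  | All x phi | Ex x phi => [seq y <- fv phi | y != x]
  end.

Fixpoint positive (phi : form) : bool :=
  match phi with
  | Bot => false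
  | Atom _ _ => true
  | And phi psi | Or phi psi | Imp phi psi => positive phi && positive psi
  | All _ phi | Ex _ phi => positive phi
  end.

(* The variables are 0 and 1, the binary letter is the one with index 0, and
   the unary letters are arbitrary. *)
Fixpoint in_fragment (phi : form) : bool :=
  match phi with
  | Bot => true
  | Atom i xs =>
      all (fun x => x < 2) xs &&
      ((size xs == 1) || (size xs == 2) && (i == 0))
  | And phi psi | Or phi psi | Imp phi psi =>
      in_fragment phi && in_fragment psi
  | All x phi | Ex x phi => (x < 2) && in_fragment phi
  end.

(** * Substitution of formulas for predicate letters *)

Definition fresh (s : seq nat) : nat := (\max_(x <- s) x).+1.

(* Capture is avoided by renaming the variable of every quantifier, needed or
   not; so the results below are meant up to renaming of bound variables. *)
Fixpoint rename (r : nat -> nat) (phi : form) : form :=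
  match phi with
  | Bot => Bot
  | Atom i xs => Atom i (map r xs)
  | And phi psi => And (rename r phi) (rename r psi)
  | Or phi psi => Or (rename r phi) (rename r psi)
  | Imp phi psi => Imp (rename r phi) (rename r psi)
  | All x phi =>
      let z := fresh (map r (fv phi)) in
      All z (rename [eta r with x |-> z] phi)
  | Ex x phi =>
      let z := fresh (map r (fv phi)) in
      Ex z (rename [eta r with x |-> z] phi)
  end.

Definition inst (xs ys : seq nat) (x : nat) : nat := nth x ys (index x xs).

(* [psub_rec i xs psi r phi] renames the free variables of [phi] by [r] and
   replaces every atom [Atom i ys] with [size ys = size xs] by [psi], with the
   (renamed) arguments [ys] in place of [xs].  The free variables of [psi] that
   are not in [xs] are parameters, and are left free. *)
Fixpoint psub_rec (i : nat) (xs : seq nat) (psi : form) (r : nat -> nat)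
    (phi : form) : form :=
  match phi with
  | Bot => Bot
  | Atom j ys =>
      let zs := map r ys in
      if (j == i) && (size ys == size xs) then rename (inst xs zs) psi
      else Atom j zs
  | And phi1 phi2 =>
      And (psub_rec i xs psi r phi1) (psub_rec i xs psi r phi2)
  | Or phi1 phi2 =>
      Or (psub_rec i xs psi r phi1) (psub_rec i xs psi r phi2)
  | Imp phi1 phi2 =>
      Imp (psub_rec i xs psi r phi1) (psub_rec i xs psi r phi2)
  | All x phi =>
      let z := fresh (fv psi ++ map r (fv phi)) in
      All z (psub_rec i xs psi [eta r with x |-> z] phi)
  | Ex x phi =>
      let z := fresh (fv psi ++ map r (fv phi)) in
      Ex z (psub_rec i xs psi [eta r with x |-> z] phi)
  end.

Definition psub (i : nat) (xs : seq nat) (psi phi : form) : form :=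
  psub_rec i xs psi id phi.

(** * Kripke semantics *)

Record frame : Type := Frame {
  world :> Type;
  acc : world -> world -> Prop;
  world_inh : inhabited world;
  acc_refl : forall w, acc w w;
  acc_anti : forall u v, acc u v -> acc v u -> u = v;
  acc_trans : forall u v w, acc u v -> acc v w -> acc u w
}.

(* The domains are subsets of a common type [univ]. *)
Record aframe (F : frame) : Type := AFrame {
  univ : Type;
  dom : F -> univ -> Prop;
  dom_inh : forall w, exists a, dom w a;
  dom_mono : forall u w, acc u w -> forall a, dom u a -> dom w a
}.

(* [interp w i] restricted to sequences of length [n] interprets the [n]-ary
   letter of index [i] at [w]. *)
Record model (F : frame) (A : aframe F) : Type := Model {
  interp : F -> nat -> seq (univ A) -> Prop;
  interp_dom : forall w i ds, interp w i ds -> List.Forall (dom w) ds;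
  interp_mono : forall u w, acc u w ->
    forall i ds, interp u i ds -> interp w i ds
}.

Fixpoint forces (F : frame) (A : aframe F) (M : model A) (w : F)
    (a : nat -> univ A) (phi : form) : Prop :=
  match phi with
  | Bot => False
  | Atom i xs => interp M w i (map a xs)
  | And phi psi => forces M w a phi /\ forces M w a psi
  | Or phi psi => forces M w a phi \/ forces M w a psi
  | Imp phi psi =>
      forall v, acc w v -> forces M v a phi -> forces M v a psi
  | All x phi =>
      forall v, acc w v -> forall d, dom v d ->
        forces M v [eta a with x |-> d] phi
  | Ex x phi => exists2 d, dom w d & forces M w [eta a with x |-> d] phi
  end.

Definition valid (F : frame) (A : aframe F) (phi : form) : Prop :=
  forall (M : model A) (w : F) (a : nat -> univ A),
    (forall x, x \in fv phi -> dom w (a x)) -> forces M w a phi.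

Definition QSIL (F : frame) (A : aframe F) : form -> Prop := valid A.

Definition QSILe (F : frame) : form -> Prop :=
  fun phi => forall A : aframe F, valid A phi.

Definition QInt : form -> Prop :=
  fun phi => forall (F : frame) (A : aframe F), valid A phi.

Definition const_aframe (F : frame) (T : Type) (inhT : inhabited T) :
  aframe F :=
  @AFrame F T (fun _ _ => True)
    (fun _ => match inhT with inhabits t => ex_intro _ t I end)
    (fun _ _ _ _ _ => I).

Definition frame_nat : frame :=
  @Frame nat (fun m n => m <= n) (inhabits 0) leqnn
    (fun m n lemn lenm => anti_leq (introT andP (conj lemn lenm)))
    (fun m n p => @leq_trans n m p).

(** * Superintuitionistic predicate logics *)

Record silogic (L : form -> Prop) : Prop := SILogic {
  silogic_QInt : forall phi, QInt phi -> L phi;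
  silogic_mp : forall phi psi, L (Imp phi psi) -> L phi -> L psi;
  silogic_sub : forall (i : nat) (xs : seq nat) (psi phi : form),
    uniq xs -> L phi -> L (psub i xs psi phi);
  silogic_gen : forall (x : nat) (phi : form), L phi -> L (All x phi)
}.

Definition positive_part (L : form -> Prop) : form -> Prop :=
  fun phi => L phi /\ positive phi.

Definition fragment (L : form -> Prop) : form -> Prop :=
  fun phi => L phi /\ in_fragment phi.

(** * Recursive functions *)

Inductive recf : nat -> Type :=
| RZero : recf 0
| RSucc : recf 1
| RProj (n : nat) (i : 'I_n) : recf n
| RComp (m n : nat) (f : recf m) (g : 'I_m -> recf n) : recf n
| RPrec (n : nat) (f : recf n) (g : recf n.+2) : recf n.+1
| RMu (n : nat) (f : recf n.+1) : recf n.

(* [eval f v y]: the partial recursive function denoted by [f] is defined at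
   [v], with value [y]. *)
Fixpoint eval (n : nat) (f : recf n) : n.-tuple nat -> nat -> Prop :=
  match f in recf n return n.-tuple nat -> nat -> Prop with
  | RZero => fun _ y => y = 0
  | RSucc => fun v y => y = (thead v).+1
  | RProj _ i => fun v y => y = tnth v i
  | RComp m _ f g => fun v y =>
      exists2 u : m.-tuple nat,
        forall i, eval (g i) v (tnth u i) & eval f u y
  | RPrec n f g => fun v =>
      let v' := [tuple of behead v] : n.-tuple nat in
      (fix rec k := match k with
       | 0 => eval f v'
       | k'.+1 => fun y =>
           exists2 z, rec k' z & eval g [tuple of k' :: z :: v'] y
       end) (thead v)
  | RMu _ f => fun v y =>
      eval f [tuple of y :: v] 0 /\
      forall k, k < y -> exists z, eval f [tuple of k :: v] z.+1
  end.

Definition computable1 (h : nat -> nat) : Prop :=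
  exists f : recf 1, forall x, eval f [tuple x] (h x).

Definition computable2 (h : nat -> nat -> nat) : Prop :=
  exists f : recf 2, forall x y, eval f [tuple x; y] (h x y).

(* The characteristic function of [R] is obtained by the coercion of [bool] to
   [nat]. *)
Definition decidable2 (R : rel nat) : Prop :=
  computable2 (fun x y => R x y).

Definition Sigma01 (A : nat -> Prop) : Prop :=
  exists2 R : rel nat, decidable2 R & forall x, A x <-> exists y, R x y.

Definition Pi01 (A : nat -> Prop) : Prop :=
  exists2 R : rel nat, decidable2 R & forall x, A x <-> forall y, R x y.

Definition many_one (A B : nat -> Prop) : Prop :=
  exists2 h : nat -> nat, computable1 h & forall x, A x <-> B (h x).

Fixpoint godel (phi : form) : nat :=
  match phi with
  | Bot => CodeSeq.code [:: 0]
  | Atom i xs => CodeSeq.code [:: 1, i & xs]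
  | And phi psi => CodeSeq.code [:: 2; godel phi; godel psi]
  | Or phi psi => CodeSeq.code [:: 3; godel phi; godel psi]
  | Imp phi psi => CodeSeq.code [:: 4; godel phi; godel psi]
  | All x phi => CodeSeq.code [:: 5; x; godel phi]
  | Ex x phi => CodeSeq.code [:: 6; x; godel phi]
  end.

Lemma godel_inj : injective godel.
Proof.
elim=> [|i xs|p IHp q IHq|p IHp q IHq|p IHp q IHq|x p IHp|x p IHp]
       [|j ys|p' q'|p' q'|p' q'|y p'|y p'] /(can_inj CodeSeq.codeK) //.
- by case=> -> ->.
- by case=> /IHp-> /IHq->.
- by case=> /IHp-> /IHq->.
- by case=> /IHp-> /IHq->.
- by case=> -> /IHp->.
- by case=> -> /IHp->.
Qed.

Definition godel_numbers (X : form -> Prop) : nat -> Prop :=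
  fun n => exists2 phi, X phi & n = godel phi.

Definition Sigma01_hard (X : form -> Prop) : Prop :=
  forall A, Sigma01 A -> many_one A (godel_numbers X).

Definition Pi01_hard (X : form -> Prop) : Prop :=
  forall A, Pi01 A -> many_one A (godel_numbers X).

(* Main.v *)
Require Import Defs.
From Stdlib Require Import Classical ClassicalEpsilon.
From mathcomp Require Import all_boot zify.

Set Implicit Arguments.
Unset Strict Implicit.
Unset Printing Implicit Defensive.

(** Over the frame of the natural numbers, a unary letter and an element of the
domain determine a time: the first world where the letter holds of the element.
An implication between two atoms compares two times.  So times can store
numbers: fix times [tau 0 < tau 1 < ...] and let an element store the value [n]
of register [r] by making [reg r] true of it from [tau n] on.  With one more
letter for each state of a register machine, an element encodes a
configuration, and a formula with two variables says that every element that
encodes a configuration has another one that encodes the next configuration.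

The worlds themselves cannot serve as the times [tau n], since formulas do not
distinguish a world from the next one.  Instead, each element owns a window,
from the time when [opens] becomes true of it to the time when [closes] does.
The conjuncts of [clock] make the windows nonempty, make every closing time an
opening time, and forbid a window to open strictly inside another one.  Hence
the closing time is a function of the opening time ([window_functional]), the
times [tau n] are obtained by iterating it ([clock_sequence]), and adding one to
a register is passing from the opening to the closing of a window.

Negation is expressed relative to the world where the refuted formula, an
implication, has a true premise and a false conclusion.  Whatever is a disjunct
of [goal] is false there, so no window opens at that world, and
[Before phi psi], which is [(phi -> psi) -> psi], says that [phi] becomes true
strictly earlier than [psi].

Both hardness results use this formula, in two variants.  In the first one the
goal contains the letter of the halting state: a halting run, which
every model of the premise contains, reaches the goal, whereas an infinite run
yields a countermodel.  In the second variant every element also has a fuel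
time, which gets strictly earlier at each step: the run of a machine that never
halts would be an infinite descent in the natural numbers, whereas a finite run
gives a countermodel.  [machine_formula_valid] follows the run inside an
arbitrary model with expanding domains, and [machine_formula_refuted] builds the
countermodel with constant domain, with one element for each step of the run and
one for each number.  So the formula is valid in one variant if the machine
halts, and in the other if it does not, and otherwise refuted.

The machines search for a witness of a decidable relation; they are obtained
from recursive functions through a small structured language
([exec_program], [reach_exec], [search_machine]).  The input of a machine is
the number of its initial state: the formula for a larger input only has more
conjuncts, and its code is computed by primitive recursion
([computable_machine_formula]). *)

(** * Structured register programs for recursive functions *)

Definition memory := nat -> nat.

Inductive cmd : Type :=
| Asg (d s : nat) (b : bool)
| Seq (c1 c2 : cmd)
| While (i j : nat) (c : cmd).

Definition assign (d s : nat) (b : bool) (m : memory) : memory :=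
  [eta m with d |-> m s + b].

Inductive exec : cmd -> memory -> memory -> Prop :=
| ExecAsg d s b m : exec (Asg d s b) m (assign d s b m)
| ExecSeq c1 c2 m1 m2 m3 :
    exec c1 m1 m2 -> exec c2 m2 m3 -> exec (Seq c1 c2) m1 m3
| ExecStop i j c m : m i = m j -> exec (While i j c) m m
| ExecLoop i j c m1 m2 m3 :
    m1 i <> m1 j -> exec c m1 m2 -> exec (While i j c) m2 m3 ->
    exec (While i j c) m1 m3.

(** The command that it ends with changes no register. *)
Definition block (cs : seq cmd) : cmd := foldr Seq (Asg 0 0 false) cs.

(** The arguments of [f] are in the registers [args], all below [b], and
register 0 always contains zero.  The result goes to register [b]; the registers
above [b] are scratch space. *)
Fixpoint program n (f : recf n) (args : seq nat) (b : nat) : cmd :=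
  match f with
  | RZero => Asg b 0 false
  | RSucc => Asg b (head 0 args) true
  | RProj _ i => Asg b (nth 0 args i) false
  | RComp m _ f g =>
      Seq (block [seq program (g i) args (b + i) | i <- enum 'I_m])
          (Seq (program f (iota b m) (b + m)) (Asg b (b + m) false))
  | RPrec _ f g =>
      Seq (Asg b 0 false)
      (Seq (program f (behead args) b.+1)
      (Seq (While b (head 0 args)
             (Seq (program g [:: b, b.+1 & behead args] b.+2)
             (Seq (Asg b.+1 b.+2 false) (Asg b b true))))
           (Asg b b.+1 false)))
  | RMu _ f =>
      Seq (Asg b 0 false)
      (Seq (program f (b :: args) b.+1)
           (While b.+1 0
             (Seq (Asg b b true) (program f (b :: args) b.+1))))
  end.

Definition agree (b : nat) (m m' : memory) : Prop :=
  forall r, r < b -> m' r = m r.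

Lemma agree_trans b m1 m2 m3 :
  agree b m1 m2 -> agree b m2 m3 -> agree b m1 m3.
Proof. by move=> h1 h2 r rb; rewrite h2 // h1. Qed.

Lemma agreeW b b' m m' : b <= b' -> agree b' m m' -> agree b m m'.
Proof. by move=> bb' h r rb; apply: h; apply: leq_trans bb'. Qed.

Lemma agree_assign b d s e m : b <= d -> agree b m (assign d s e m).
Proof. by move=> bd r rb; rewrite /assign /= ltn_eqF // (leq_trans rb). Qed.

Lemma assignE d s e m : assign d s e m d = m s + e.
Proof. by rewrite /assign /= eqxx. Qed.

Lemma map_agree b m m' args :
  all (gtn b) args -> agree b m m' -> map m' args = map m args.
Proof. by move=> /allP argsb mm'; apply/eq_in_map => r /argsb /mm'. Qed.

Lemma all_gtnW b b' (s : seq nat) : b <= b' -> all (gtn b) s -> all (gtn b') s.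
Proof. by move=> bb'; apply: sub_all => r /= rb; apply: leq_trans bb'. Qed.

(** Each command preserves the registers below its own result, hence the
results of the commands before it. *)
Lemma exec_block (cs : seq cmd) (ys : seq nat) b m0 :
  0 < b ->
  (forall j m, j < size cs -> agree b m0 m ->
     exists m', [/\ exec (nth (Asg 0 0 false) cs j) m m',
                    agree (b + j) m m' & m' (b + j) = nth 0 ys j]) ->
  exists m', [/\ exec (block cs) m0 m', agree b m0 m' &
                 forall j, j < size cs -> m' (b + j) = nth 0 ys j].
Proof.
elim: cs ys b m0 => [|c cs IH] ys b m0 b0 H.
  exists (assign 0 0 false m0); split=> //; first exact: ExecAsg.
  by move=> r _; rewrite /assign /=; case: eqP => // ->; rewrite addn0.
have [m1 [e1 a1 v1]] := H 0 m0 isT (fun _ _ => erefl).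
rewrite addn0 in a1 v1.
have [||m2 [e2 a2 v2]] := IH (behead ys) b.+1 m1 => //.
  move=> j m js am; have [|m' [e' a' v']] := H j.+1 m js.
    by apply: agree_trans a1 (agreeW _ am).
  by exists m'; rewrite addSnnS nth_behead.
exists m2; split; first exact: ExecSeq e1 e2.
  by apply: agree_trans a1 (agreeW _ a2).
case=> [|j] js; first by rewrite addn0 a2 // v1.
by rewrite -addSnnS v2 // nth_behead.
Qed.

(** [n] is the number of passages through the loop and [I k] what holds after
[k] of them. *)
Lemma exec_while i j c (I : nat -> memory -> Prop) n m :
  (forall k m, k < n -> I k m ->
     m i <> m j /\ exists2 m', exec c m m' & I k.+1 m') ->
  (forall m, I n m -> m i = m j) ->
  I 0 m -> exists2 m', exec (While i j c) m m' & I n m'.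
Proof.
elim: n I m => [|n IH] I m step stop I0.
  by exists m => //; apply: ExecStop; apply: stop.
have [ne [m1 e1 I1]] := step 0 m isT I0.
have [|m2 e2 I2] := IH (fun k => I k.+1) m1 _ stop I1.
  by move=> k m' kn; apply: step.
by exists m2 => //; apply: ExecLoop ne e1 e2.
Qed.

(** The inner recursion of [eval] at [RPrec], named in order to reason on it by
induction on the recursion argument. *)
Definition prec n (f : recf n) (g : recf n.+2) (v : n.-tuple nat) :
    nat -> nat -> Prop :=
  fix rec k := match k with
  | 0 => eval f v
  | k'.+1 => fun y =>
      exists2 z, rec k' z & eval g [tuple of k' :: z :: v] y
  end.

Lemma eval_prec n (f : recf n) (g : recf n.+2) a (v : n.-tuple nat) y :
  eval (RPrec f g) [tuple of a :: v] y <-> prec f g v a y.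
Proof.
have wv : [tuple of behead [tuple of a :: v]] = v by exact: val_inj.
by change (prec f g [tuple of behead [tuple of a :: v]] a y <-> prec f g v a y);
  rewrite wv.
Qed.

(** Only the evaluations that terminate are followed.  This suffices: the only
search that may run forever is the one for a witness of the decidable relation,
which is not part of the recursive function. *)
Lemma exec_program n (f : recf n) (v : n.-tuple nat) y args b m :
  eval f v y -> 0 < b -> all (gtn b) args -> map m args = v -> m 0 = 0 ->
  exists m', [/\ exec (program f args b) m m', agree b m m' & m' b = y].
Proof.
elim: f v y args b m => {n}.
- move=> v y args b m /= -> b0 _ _ m0; exists (assign b 0 false m).
  by split; [exact: ExecAsg | exact: agree_assign | rewrite assignE addn0].
- move=> v y args b m /= -> b0 _ mv m0; exists (assign b (head 0 args) true m).
  split; [exact: ExecAsg | exact: agree_assign | rewrite assignE addn1].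
  move: mv; case/tupleP: v => a t; rewrite theadE.
  by case: args => [|r s] //= [->].
- move=> n i v y args b m /= -> b0 _ mv m0.
  exists (assign b (nth 0 args i) false m).
  split; [exact: ExecAsg | exact: agree_assign | rewrite assignE addn0].
  have sz : size args = n by rewrite -(size_map m) mv size_tuple.
  by rewrite (tnth_nth 0) -mv (nth_map 0) ?sz.
- move=> p n f IHf g IHg v y args b m /= [u gu fu] b0 argsb mv m0.
  have [|j m1 js am1|m1 [e1 a1 v1]] := @exec_block
    [seq program (g i) args (b + i) | i <- enum 'I_p] u b m => //.
    rewrite size_map size_enum_ord in js.
    rewrite (nth_map (Ordinal js)) ?size_enum_ord //.
    rewrite (nth_ord_enum _ (Ordinal js)) /=.
    have [||||m2 [e2 a2 v2]] := IHg (Ordinal js) v _ args (b + j) m1 (gu _).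
    + by rewrite addn_gt0 b0.
    + exact: all_gtnW (leq_addr _ _) argsb.
    + by rewrite (map_agree argsb am1).
    + by rewrite am1.
    by exists m2; split=> //; rewrite v2 (tnth_nth 0).
  rewrite size_map size_enum_ord in v1.
  have [||||m2 [e2 a2 v2]] := IHf u y (iota b p) (b + p) m1 fu.
  + by rewrite addn_gt0 b0.
  + by apply/allP => r; rewrite mem_iota => /andP[].
  + apply: (@eq_from_nth _ 0); first by rewrite size_map size_iota size_tuple.
    move=> i; rewrite size_map size_iota => ip.
    by rewrite (nth_map 0) ?size_iota // nth_iota // v1.
  + by rewrite a1.
  exists (assign b (b + p) false m2); split.
  + exact: ExecSeq e1 (ExecSeq e2 (ExecAsg _ _ _ _)).
  + apply: agree_trans a1 (agree_trans _ (agree_assign _ _ _ (leqnn _))).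
    exact: agreeW (leq_addr _ _) a2.
  + by rewrite assignE addn0.
- move=> n f IHf g IHg; case/tupleP=> a v y args b m.
  move=> /eval_prec recy b0; case: args => [//|r args] /= /andP[rb argsb] [mr mv] m0.
  (* As [eval] is a relation, the intermediate values are chosen beforehand. *)
  have [z [zy z0 zS]] : exists z : nat -> nat, [/\ z a = y, eval f v (z 0) &
      forall k, k < a -> eval g [tuple of k :: z k :: v] (z k.+1)].
    elim: a y recy {mr} => [|a IH] y /=; first by exists (fun _ => y).
    case=> t /IH[z [zt z0 zS]] gy; pose z' := [eta z with a.+1 |-> y].
    have z'E k : k <= a -> z' k = z k.
      by move=> ka; rewrite /z' /= ltn_eqF.
    have z'a : z' a.+1 = y by rewrite /z' /= eqxx.
    exists z'; split=> [||k ka] //; rewrite z'E //.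
    move: ka; rewrite ltnS leq_eqVlt => /orP[/eqP->|ka]; first by rewrite z'a zt.
    by rewrite z'E //; apply: zS.
  have am1 : agree b m (assign b 0 false m) by exact: agree_assign.
  have [||||m2 [e2 a2 v2]] := IHf v _ args b.+1 (assign b 0 false m) z0.
  + by [].
  + exact: all_gtnW argsb.
  + by rewrite (map_agree argsb am1).
  + by rewrite am1.
  pose I k (m' : memory) := [/\ agree b m m', m' b = k & m' b.+1 = z k].
  have [k m3 ka [a3 k3 v3]|m3 []||m3 e3 [a3 k3 v3]] := @exec_while b r
    (Seq (program g [:: b, b.+1 & args] b.+2)
         (Seq (Asg b.+1 b.+2 false) (Asg b b true))) I a m2.
  + split; first by rewrite k3 a3 // mr; lia.
    have [||||m4 [e4 a4 v4]] := IHg _ _ [:: b, b.+1 & args] b.+2 m3 (zS k ka).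
    - by [].
    - by rewrite /= !ltnS leqnSn leqnn /=; apply: all_gtnW argsb; lia.
    - by rewrite /= k3 v3 (map_agree argsb a3) mv.
    - by rewrite a3.
    exists (assign b b true (assign b.+1 b.+2 false m4)).
      exact: ExecSeq e4 (ExecSeq (ExecAsg _ _ _ _) (ExecAsg _ _ _ _)).
    have a5 := agree_assign b.+2 false m4 (leqnSn b).
    split.
    - apply: agree_trans (agree_assign _ _ _ (leqnn _)).
      by apply: agree_trans a3 (agree_trans (agreeW _ a4) a5); lia.
    - by rewrite assignE {1}/assign /= ltn_eqF // a4 // k3 addn1.
    - by rewrite {1}/assign /= gtn_eqF // assignE v4 addn0.
  + by move=> a3 -> _; rewrite a3.
  + split=> //; first by apply: agree_trans am1 (agreeW _ a2).
    by rewrite a2 // assignE m0.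
  exists (assign b b.+1 false m3); split.
  + by apply: ExecSeq (ExecAsg _ _ _ _) (ExecSeq e2 (ExecSeq e3 (ExecAsg _ _ _ _))).
  + exact: agree_trans a3 (agree_assign _ _ _ (leqnn _)).
  + by rewrite assignE addn0 v3.
- move=> n f IHf v y args b m /= [fy fk] b0 argsb mv m0.
  have body k z m1 : eval f [tuple of k :: v] z -> agree b m m1 -> m1 b = k ->
      exists m2, [/\ exec (program f (b :: args) b.+1) m1 m2, agree b m m2,
                     m2 b = k & m2 b.+1 = z].
    move=> fz a1 v1.
    have [||||m2 [e2 a2 v2]] := IHf _ _ (b :: args) b.+1 m1 fz.
    + by [].
    + by rewrite /= leqnn /=; apply: all_gtnW argsb.
    + by rewrite /= v1 (map_agree argsb a1) mv.
    + by rewrite a1.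
    exists m2; split=> //; last by rewrite a2.
    by apply: agree_trans a1 (agreeW _ a2).
  have test k : k <= y ->
      exists2 z, eval f [tuple of k :: v] z & (z == 0) = (k == y).
    rewrite leq_eqVlt => /orP[/eqP->|ky]; first by exists 0; rewrite ?eqxx.
    by have [z fz] := fk k ky; exists z.+1 => //; rewrite (ltn_eqF ky).
  have [z0 f0 t0] := test 0 (leq0n _).
  have [|m1 [e1 a1 k1 v1]] := body 0 z0 (assign b 0 false m) f0
    (agree_assign _ _ _ (leqnn _)).
    by rewrite assignE m0.
  pose I k (m' : memory) := [/\ agree b m m', m' b = k & (m' b.+1 == 0) = (k == y)].
  have [k m3 ky [a3 k3 v3]|m3 []||m3 e3 [a3 k3 v3]] := @exec_while b.+1 0
    (Seq (Asg b b true) (program f (b :: args) b.+1)) I y m1.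
  + split; first by move=> /eqP; rewrite (a3 0) // m0 v3 ltn_eqF.
    have [z fz tz] := test k.+1 ky.
    have [||m4 [e4 a4 k4 v4]] := body _ _ (assign b b true m3) fz.
    - exact: agree_trans a3 (agree_assign _ _ _ (leqnn _)).
    - by rewrite assignE k3 addn1.
    by exists m4; [exact: ExecSeq (ExecAsg _ _ _ _) e4 | split; rewrite ?v4].
  + by move=> a3 _; rewrite eqxx => /eqP ->; rewrite a3.
  + by split; rewrite ?v1.
  exists m3; split=> //.
  by apply: ExecSeq (ExecAsg _ _ _ _) (ExecSeq e1 e3).
Qed.

(** * Flat register machines *)

Inductive instr : Type :=
| Move (d s : nat) (b : bool) (t : nat)
| Branch (i j t e : nat).

Definition config : Type := nat * memory.

(** State 0 is the halting state.  A halted machine keeps its configuration, so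
that runs are infinite sequences in all cases. *)
Definition step (prog : nat -> instr) (c : config) : config :=
  if c.1 == 0 then c else
  match prog c.1 with
  | Move d s b t => (t, assign d s b c.2)
  | Branch i j t e => (if c.2 i == c.2 j then t else e, c.2)
  end.

Definition run (prog : nat -> instr) (q k : nat) : config :=
  iter k (step prog) (q, fun=> 0).

Definition halts (prog : nat -> instr) (q : nat) : Prop :=
  exists k, (run prog q k).1 = 0.

Definition reach (prog : nat -> instr) (c c' : config) : Prop :=
  exists k, iter k (step prog) c = c'.

Lemma reach_refl prog c : reach prog c c.
Proof. by exists 0. Qed.

Lemma reach_trans prog c2 c1 c3 :
  reach prog c1 c2 -> reach prog c2 c3 -> reach prog c1 c3.
Proof. by move=> [k <-] [l <-]; exists (l + k); rewrite iterD. Qed.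

Lemma reach_step prog c c' :
  reach prog (step prog c) c' -> reach prog c c'.
Proof. by move=> [k <-]; exists k.+1; rewrite iterSr. Qed.

Lemma iter_halted prog c k l :
  k <= l -> (iter k (step prog) c).1 = 0 ->
  iter l (step prog) c = iter k (step prog) c.
Proof.
move=> /subnK <- h; elim: (l - k) => //= n ->.
by rewrite /step h.
Qed.

Fixpoint cmd_size (c : cmd) : nat :=
  match c with
  | Asg _ _ _ => 1
  | Seq c1 c2 => cmd_size c1 + cmd_size c2
  | While _ _ c => (cmd_size c).+1
  end.

(** The code starts at the address [a] and continues at the address [e]. *)
Fixpoint compile (c : cmd) (a e : nat) : seq instr :=
  match c with
  | Asg d s b => [:: Move d s b e]
  | Seq c1 c2 =>
      compile c1 a (a + cmd_size c1) ++ compile c2 (a + cmd_size c1) e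
  | While i j c => Branch i j e a.+1 :: compile c a.+1 a
  end.

Lemma size_compile c a e : size (compile c a e) = cmd_size c.
Proof.
by elim: c a e => //= [c1 IH1 c2 IH2|i j c IH] a e; rewrite ?size_cat ?IH1 ?IH2 ?IH.
Qed.

Definition dummy : instr := Move 0 0 false 0.

Definition code_at (prog : nat -> instr) (a : nat) (l : seq instr) : Prop :=
  forall n, n < size l -> prog (a + n) = nth dummy l n.

Lemma code_at_cons prog a i l :
  code_at prog a (i :: l) -> prog a = i /\ code_at prog a.+1 l.
Proof.
move=> h; split; first by rewrite -(addn0 a) h.
by move=> n nl; rewrite addSnnS h.
Qed.

Lemma code_at_cat prog a l1 l2 :
  code_at prog a (l1 ++ l2) ->
  code_at prog a l1 /\ code_at prog (a + size l1) l2.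
Proof.
move=> h; split=> n nl; first by rewrite h ?nth_cat ?nl // size_cat ltn_addr.
rewrite -addnA h ?size_cat ?ltn_add2l // nth_cat ltnNge leq_addr /=.
by rewrite addKn.
Qed.

(** The address 0 is excluded, since the machine halts there. *)
Lemma reach_exec prog c a e m m' :
  0 < a -> code_at prog a (compile c a e) -> exec c m m' ->
  reach prog (a, m) (e, m').
Proof.
move=> + + ex; elim: ex a e => {c m m'}.
- move=> d s b m a e a0 /code_at_cons[pa _]; exists 1.
  by rewrite /= /step /= gtn_eqF // pa.
- move=> c1 c2 m1 m2 m3 _ IH1 _ IH2 a e a0 /= /code_at_cat[h1 h2].
  apply: reach_trans (IH1 _ _ a0 h1) (IH2 _ _ _ _); first lia.
  by rewrite size_compile in h2.
- move=> i j c m mij a e a0 /= /code_at_cons[pa _]; exists 1.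
  by rewrite /= /step /= gtn_eqF // pa mij eqxx.
- move=> i j c m1 m2 m3 /eqP mij _ IHc _ IHw a e a0 /= h.
  have [pa h1] := code_at_cons h.
  apply: reach_step; rewrite /step /= gtn_eqF // pa (negbTE mij).
  exact: reach_trans (IHc _ _ _ h1) (IHw _ _ a0 h).
Qed.

(** A passage through a loop takes at least one step: this is why a loop that is
never left keeps the machine from halting. *)
Lemma reach_enter prog i j c a e m m' :
  0 < a -> code_at prog a (compile (While i j c) a e) ->
  m i <> m j -> exec c m m' ->
  exists2 k, 0 < k & iter k (step prog) (a, m) = (a, m').
Proof.
move=> a0 /= /code_at_cons[pa h] /eqP mij ex.
have [//|k kP] := reach_exec _ h ex.
by exists k.+1 => //; rewrite iterSr /step /= gtn_eqF // pa (negbTE mij).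
Qed.

(** * Unbounded search *)

(** In the search for [y] with [R x y = b], register 1 contains [x], register 2
the current [y], register 3 the number one, and register 4 the truth value of
[R x y], which the loop compares with the content of register 3 or 0. *)
Definition search_init (f : recf 2) : cmd :=
  Seq (Asg 3 0 true) (program f [:: 1; 2] 4).

Definition search_loop (f : recf 2) (b : bool) : cmd :=
  While 4 (if b then 3 else 0) (Seq (Asg 2 2 true) (program f [:: 1; 2] 4)).

Definition search_code (f : recf 2) (b : bool) : seq instr :=
  compile (Seq (search_init f) (search_loop f b)) 1 0.

Definition targets (i : instr) : seq nat :=
  match i with Move _ _ _ t => [:: t] | Branch _ _ t e => [:: t; e] end.

Definition registers (i : instr) : seq nat :=
  match i with Move d s _ _ => [:: d; s] | Branch i j _ _ => [:: i; j] end.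

(** The input is the distance of the initial state from [p]: from [p + x] the
machine counts down to [p], adding one to register 1 in each step.  So one
program serves for all inputs. *)
Definition with_input (l : seq instr) (p q : nat) : instr :=
  if q < p then nth dummy (dummy :: l) q
  else if q == p then Move 0 0 false 1 else Move 1 1 true q.-1.

Lemma with_input_gt l p q : p < q -> with_input l p q = Move 1 1 true q.-1.
Proof. by move=> pq; rewrite /with_input ltnNge ltnW //= gtn_eqF. Qed.

Lemma reach_input l p x : 0 < p ->
  exists m, [/\ reach (with_input l p) (p + x, fun=> 0) (1, m),
                m 1 = x & forall r, r != 1 -> m r = 0].
Proof.
move=> p0.
suff H y : exists m, [/\ reach (with_input l p) (p + x, fun=> 0) (p + (x - y), m),
    m 1 = minn y x & forall r, r != 1 -> m r = 0].
  have [m [h m1 mr]] := H x; exists (assign 0 0 false m).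
  rewrite subnn addn0 minnn in h m1; split.
  - apply: reach_trans h (reach_step _); rewrite /step /= gtn_eqF //.
    by rewrite /with_input ltnn eqxx; apply: reach_refl.
  - by rewrite /assign /= m1.
  - by move=> r r1; rewrite /assign /= addn0; case: ifP => _; apply: mr.
elim: y => [|y [m [h m1 mr]]].
  by exists (fun=> 0); rewrite subn0 min0n; split=> //; apply: reach_refl.
case: (ltnP y x) => yx; last first.
  by exists m; rewrite m1; split=> //; [have -> : x - y.+1 = x - y by lia | lia].
exists (assign 1 1 true m); split.
- apply: reach_trans h (reach_step _); rewrite /step /= gtn_eqF ?addn_gt0 ?p0 //.
  rewrite with_input_gt; last lia.
  have E : (p + (x - y)).-1 = p + (x - y.+1) by lia.
  by rewrite E; apply: reach_refl.
- by rewrite assignE m1; lia.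
- by move=> r r1; rewrite /assign /= (negbTE r1) mr.
Qed.

Lemma mem_flatten_nth (g : instr -> seq nat) l q x :
  q < size l -> x \in g (nth dummy l q) -> x \in flatten (map g l).
Proof.
elim: l q => //= i l IH [|q] ql xg; rewrite mem_cat; first by rewrite xg.
by rewrite (IH q) ?orbT.
Qed.

(** The bound [p] exceeds the jump targets as well as the addresses of the code.
Hence the states up to any [N >= p] are closed under the transitions, and the
instructions of these states describe all runs from [N]. *)
Lemma search_machine (R : rel nat) (b : bool) : decidable2 R ->
  exists p k (prog : nat -> instr),
    [/\ 0 < p,
        forall q, p < q -> prog q = Move 1 1 true q.-1,
        forall q N, p <= N -> q <= N ->
          all (gtn k) (registers (prog q)) && all (geq N) (targets (prog q)) &
        forall x, halts prog (p + x) <-> exists y, R x y = b].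
Proof.
move=> [f fR].
pose l := search_code f b.
pose p := (maxn (size l) (\max_(t <- flatten (map targets l)) t)).+1.
pose k := (\max_(r <- [:: 1 & flatten (map registers l)]) r).+1.
pose prog := with_input l p.
exists p, k, prog; split=> //.
- exact: with_input_gt.
- move=> q N pN qN; rewrite /prog /with_input.
  case: ltnP => qp.
    case: q qp {qN} => [_|q qp] /=; first by lia.
    case: (ltnP q (size l)) => ql; last by rewrite nth_default //=; lia.
    apply/andP; split; apply/allP => r /(mem_flatten_nth ql) h /=.
      by rewrite ltnS; apply: leq_bigmax_seq; rewrite // inE h orbT.
    apply: leq_trans pN; rewrite /p; apply: leqW.
    by apply: leq_trans (leq_maxr _ _); apply: leq_bigmax_seq.
  have k1 : 1 < k by rewrite ltnS; apply: leq_bigmax_seq; rewrite // inE.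
  by case: eqP => _ /=; lia.
move=> x.
have p0 : 0 < p by [].
have [m0 [h0 m01 m0r]] := reach_input l x p0.
have lcode : code_at prog 1 l.
  move=> n nl; rewrite /prog /with_input add1n ifT //.
  by rewrite /p ltnS; apply: leq_trans nl (leq_maxl _ _).
pose h := 1 + cmd_size (search_init f).
have [icode wcode] : code_at prog 1 (compile (search_init f) 1 h) /\
    code_at prog h (compile (search_loop f b) h 0).
  have [] := @code_at_cat prog 1 (compile (search_init f) 1 h)
    (compile (search_loop f b) h 0) lcode.
  by rewrite size_compile.
pose I y (m : memory) := [/\ m 0 = 0, m 1 = x, m 2 = y, m 3 = 1 & m 4 = R x y].
have test y m : I y m -> (m 4 == m (if b then 3 else 0)) = (R x y == b).
  by case=> m_0 m_1 m_2 m_3 ->; case: (b) => /=; rewrite ?m_3 ?m_0; case: (R x y).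
have body m y : m 0 = 0 -> m 1 = x -> m 2 = y -> m 3 = 1 ->
    exists2 m', exec (program f [:: 1; 2] 4) m m' & I y m'.
  move=> m_0 m_1 m_2 m_3.
  have [||||m' [e' a' v']] := @exec_program _ f _ _ [:: 1; 2] 4 m (fR x y) => //.
    by rewrite /= m_1 m_2.
  by exists m' => //; split; rewrite // a'.
have loop y m : I y m ->
    exists2 m', exec (Seq (Asg 2 2 true) (program f [:: 1; 2] 4)) m m' & I y.+1 m'.
  case=> m_0 m_1 m_2 m_3 _.
  have [||||m' e' I'] := body (assign 2 2 true m) y.+1 => //.
    by rewrite assignE m_2 addn1.
  by exists m' => //; apply: ExecSeq (ExecAsg _ _ _ _) e'.
have [m1 h1 I1] : exists2 m1, reach prog (p + x, fun=> 0) (h, m1) & I 0 m1.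
  have [||||m1 e1 I1] := body (assign 3 0 true m0) 0.
  + by rewrite /assign /= m0r.
  + by rewrite /assign /= m01.
  + by rewrite /assign /= m0r.
  + by rewrite assignE m0r.
  exists m1 => //; apply: reach_trans h0 _.
  by apply: (reach_exec _ icode) => //; apply: ExecSeq (ExecAsg _ _ _ _) e1.
have [k1 hk1] := h1.
split.
- move=> [n hn]; have [//|none] := classic (exists y, R x y = b).
  (* Without a witness the loop is entered again and again, and the [j]-th step
     falls inside some passage, after which the machine has not halted. *)
  suff H j : forall y m, I y m -> (iter j (step prog) (h, m)).1 <> 0.
    case: (H n _ _ I1); rewrite -hk1 -iterD.
    by rewrite /run in hn; rewrite (iter_halted (leq_addr k1 n) hn).
  elim/ltn_ind: j => j IH y m Im.
  have [m' e' I'] := loop _ _ Im.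
  have [||i i0 hi] := reach_enter _ wcode _ e'.
  + by [].
  + by apply/eqP; rewrite (test _ _ Im); apply/eqP => e; apply: none; exists y.
  case: (ltnP j i) => ji; last first.
    by rewrite -(subnK ji) iterD hi; apply: IH I'; lia.
  move=> j0; have := iter_halted (ltnW ji) j0; rewrite hi => e.
  by rewrite -e in j0.
- move=> ex.
  have [y [yb ymin]] : exists y, R x y = b /\ forall z, z < y -> R x z <> b.
    have ex' : exists y, R x y == b by case: ex => y e; exists y; apply/eqP.
    case: (ex_minnP ex') => y /eqP yb ymin; exists y; split=> // z zy zb.
    by have := ymin z; rewrite zb eqxx => /(_ isT); lia.
  have [j m jy Ij|m Iy||m2 e2 _] := @exec_while 4 (if b then 3 else 0)
    (Seq (Asg 2 2 true) (program f [:: 1; 2] 4)) I y m1.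
  + split; last exact: loop.
    by apply/eqP; rewrite (test _ _ Ij); apply/eqP/ymin.
  + by apply/eqP; rewrite (test _ _ Iy) yb.
  + exact: I1.
  have [//|j hj] := reach_trans h1 (reach_exec _ wcode e2).
  by exists j; rewrite /run hj.
Qed.

(** * The formula of a machine *)

Definition letter (i x : nat) : form := Atom i [:: x].
Definition Iff (phi psi : form) : form := And (Imp phi psi) (Imp psi phi).
(** At a world where [psi] fails this says that some later world satisfies [phi]
but not [psi]: in a linear frame, [phi] becomes true strictly before [psi]. *)
Definition Before (phi psi : form) : form := Imp (Imp phi psi) psi.

(** The letters with numbers 0 and 1 delimit the window of an element, the
interval of the worlds where the first is true of it and the second is not.
Those with odd numbers from 3 on stand for registers, and those with even
numbers from 4 on for states. *)
Definition opens : nat -> form := letter 0.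
Definition closes : nat -> form := letter 1.
Definition fuel_letter : nat := 2.
Definition fuel : nat -> form := letter fuel_letter.
Definition reg_letter (r : nat) : nat := r.*2.+3.
Definition reg (r : nat) : nat -> form := letter (reg_letter r).
Definition state_letter (q : nat) : nat := q.*2.+4.
Definition state (q : nat) : nat -> form := letter (state_letter q).

(** Windows are nonempty; the end of each window is the start of another one; of
two windows, the one that starts earlier ends no later than the other starts. *)
Definition clock : form :=
  And (All 0 (Before (opens 0) (closes 0)))
  (And (All 0 (Ex 1 (Iff (closes 0) (opens 1))))
       (All 0 (All 1 (Or (Imp (opens 0) (opens 1))
                         (Imp (opens 1) (closes 0)))))).

Definition conjunction (phi : form) (F : nat -> form) (s : seq nat) : form :=
  foldr And phi (map F s).

Section Formula.
Variables (k : nat) (b : bool).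

(** The element 1 is in the state [t], and agrees with the element 0 on the
registers of [s].  If [b] is true, it also has an earlier fuel time. *)
Definition next_config (t : nat) (s : seq nat) : form :=
  conjunction (if b then And (state t 1) (Before (fuel 1) (fuel 0)) else state t 1)
    (fun r => Iff (reg r 0) (reg r 1)) s.

Definition registers_except (d : nat) : seq nat := [seq r <- iota 0 k | r != d].

(** A [Move] makes the source register of the element coincide with the start of
its own window, so that the new value is one of the two ends of this window.  For
a [Branch], two values differ if one of the two times is strictly earlier. *)
Definition rule (q : nat) (i : instr) : form :=
  All 0 (Imp (state q 0)
    match i with
    | Move d s e t =>
        And (Iff (reg s 0) (opens 0))
            (Ex 1 (And (Iff (if e then closes 0 else opens 0) (reg d 1))
                       (next_config t (registers_except d))))
    | Branch i j t e =>
        Or (And (Iff (reg i 0) (reg j 0)) (Ex 1 (next_config t (iota 0 k))))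
           (And (Or (Before (reg i 0) (reg j 0)) (Before (reg j 0) (reg i 0)))
                (Ex 1 (next_config e (iota 0 k))))
    end).

(** The recursion is on the largest state treated, so that the formula for the
next input is obtained by adding one conjunct. *)
Fixpoint rules (prog : nat -> instr) (n : nat) : form :=
  match n with
  | 0 => clock
  | q.+1 => And (rule q.+1 (prog q.+1)) (rules prog q)
  end.

Definition start (n : nat) : form :=
  Ex 0 (conjunction (state n 0) (fun r => Iff (reg r 0) (opens 0)) (iota 0 k)).

(** If [b] is false, reaching the halting state makes the goal true.  If [b] is
true, its failure puts all fuel times after the current world, so that [Before] makes
each step of the run decrease them strictly. *)
Definition goal_letter : nat := if b then fuel_letter else state_letter 0.

Definition goal : form := Ex 0 (Or (opens 0) (letter goal_letter 0)).

Definition machine_formula (prog : nat -> instr) (n : nat) : form :=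
  Imp (And (start n) (rules prog n)) goal.

End Formula.

Lemma forces_conjunction (F : frame) (A : aframe F) (M : model A) w a phi G s :
  forces M w a (conjunction phi G s) <->
  forces M w a phi /\ forall r, r \in s -> forces M w a (G r).
Proof.
elim: s => [|r s IH] /=; first by split=> [|[]].
rewrite -/(conjunction phi G s) IH; split=> [[h [? h']]|[? h]]; last first.
  by split; [|split=> //] => [|r' r's]; apply: h; rewrite inE ?eqxx ?r's ?orbT.
by split=> // r'; rewrite inE => /orP[/eqP->|/h'].
Qed.

(** * Following the run in a model *)

Section Soundness.
Variables (A : aframe frame_nat) (M : model A) (v : nat).

Notation holds i d w := (@interp frame_nat A M w i [:: d]).
Notation D d := (@dom frame_nat A v d).

(** The time of the letter [i] at the element [d], as seen from the world [v]
where the goal fails.  The strict inequality leaves room for [Before], which is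
trivially true at a world where its conclusion holds. *)
Definition since (i : nat) (d : univ A) (t : nat) : Prop :=
  v < t /\ forall u, v <= u -> (holds i d u <-> t <= u).

Definition same i d j e : Prop :=
  forall u, v <= u -> (holds i d u <-> holds j e u).

Lemma forces_Iff i j x y a :
  forces M v a (Iff (letter i x) (letter j y)) <-> same i (a x) j (a y).
Proof.
split=> [[h1 h2] u vu|h]; first by split; [exact: h1 | exact: h2].
by split=> u vu /=; apply h.
Qed.

Lemma forces_Before i j x y a :
  forces M v a (Before (letter i x) (letter j y)) -> ~ holds j (a y) v ->
  exists u, [/\ v <= u, holds i (a x) u & ~ holds j (a y) u].
Proof.
move=> h nj; apply: NNPP => none; apply: nj; apply: (h v (leqnn v)) => u vu iu.
by apply: NNPP => nj; apply: none; exists u.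
Qed.

Lemma since_uniq i d t t' : since i d t -> since i d t' -> t = t'.
Proof.
move=> [vt h] [vt' h']; apply/eqP; rewrite eqn_leq.
apply/andP; split; first by apply/(h t' (ltnW vt'))/(h' t' (ltnW vt')).
by apply/(h' t (ltnW vt))/(h t (ltnW vt)).
Qed.

Lemma same_since i d j e t : same i d j e -> since i d t -> since j e t.
Proof. by move=> h [vt ht]; split=> // u vu; rewrite -(h u vu) ht. Qed.

Lemma same_sym i d j e : same i d j e -> same j e i d.
Proof. by move=> h u vu; rewrite h. Qed.

Lemma since_exists i d u :
  v <= u -> holds i d u -> ~ holds i d v -> exists t, since i d t.
Proof.
move=> vu iu niv.
pose P n := (v <= n) &&
  (if excluded_middle_informative (holds i d n) then true else false).
have PP n : reflect (v <= n /\ holds i d n) (P n).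
  rewrite /P; case: excluded_middle_informative => h; rewrite ?andbT ?andbF.
    by apply: (iffP idP) => [|[]].
  by apply: ReflectF => -[].
have exP : exists n, P n by exists u; apply/PP.
case: (ex_minnP exP) => t /PP[vt it] tmin; exists t; split.
  by rewrite ltn_neqAle vt andbT; apply/eqP => e; rewrite e in niv.
move=> n vn; split=> [h|tn]; first by apply/tmin/PP.
by have := @interp_mono _ _ M t n tn i [:: d] it.
Qed.

Variables (k : nat) (b : bool) (prog : nat -> instr) (a : nat -> univ A).
Hypothesis not_goal : ~ forces M v a (goal b).
Hypothesis clock_v : forces M v a clock.

Lemma not_opens d : D d -> ~ holds 0 d v.
Proof. by move=> Dd h; apply: not_goal; exists d => //; left. Qed.

Lemma not_goal_letter d : D d -> ~ holds (goal_letter b) d v.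
Proof. by move=> Dd h; apply: not_goal; exists d => //; right. Qed.

Lemma closes_opens d : D d -> exists2 e, D e & same 1 d 0 e.
Proof.
move=> Dd; have [_ [h _]] := clock_v.
by have [e De /forces_Iff he] := h v (leqnn v) d Dd; exists e.
Qed.

Lemma opens_since d : D d -> exists t, since 0 d t.
Proof.
move=> Dd; have [h _] := clock_v.
have [|u [vu ou cu]] := forces_Before (h v (leqnn v) d Dd).
  by have [e De] := closes_opens Dd; move=> /(_ v (leqnn v)) /= ->; apply: not_opens.
by apply: since_exists vu ou (not_opens Dd).
Qed.

Lemma closes_since d t : D d -> since 0 d t ->
  exists2 t', since 1 d t' & t < t'.
Proof.
move=> Dd [vt ht]; have [e De ce] := closes_opens Dd.
have [t' t'P] := opens_since De; have c' := same_since (same_sym ce) t'P.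
exists t' => //; have [h _] := clock_v.
have [|u [vu ou cu]] := forces_Before (h v (leqnn v) d Dd).
  by move/(ce v (leqnn v)); apply: not_opens.
have [_ h'] := c'; rewrite ltnNge; apply/negP => t't.
by apply: cu; apply/h' => //; apply: leq_trans t't _; apply/ht.
Qed.

(** The only use of the last conjunct of [clock]: its first disjunct is excluded
by [t < s], and the second one compares [s] with [t']. *)
Lemma closes_before_opens d e t t' s : D d -> D e ->
  since 0 d t -> since 1 d t' -> since 0 e s -> t < s -> t' <= s.
Proof.
move=> Dd De [vt ht] [vt' ht'] [vs hs] ts; have [_ [_ h]] := clock_v.
case: (h v (leqnn v) d Dd v (leqnn v) e De) => /= h'.
  have := h' t (ltnW vt); rewrite /= (hs t (ltnW vt)) (ht t (ltnW vt)).
  by move=> /(_ (leqnn t)); rewrite leqNgt ts.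
apply/(ht' s (ltnW vs)); apply: h'; rewrite /= ?(ltnW vs) //.
by apply/hs; rewrite ?(ltnW vs).
Qed.

Definition window (t t' : nat) : Prop :=
  exists d, [/\ D d, since 0 d t & since 1 d t'].

(** If the two windows had different ends, the earlier end would be the start of
a third window, strictly inside the longer of the two. *)
Lemma window_functional t t1 t2 : window t t1 -> window t t2 -> t1 = t2.
Proof.
(* By symmetry it is enough to compare the ends in one direction. *)
suff le u u' : window t u -> window t u' -> u <= u'.
  by move=> h1 h2; apply/eqP; rewrite eqn_leq !le.
move=> [d [Dd o c]] [d' [Dd' o' c']].
have [e De ce] := closes_opens Dd'; have oe := same_since ce c'.
apply: (closes_before_opens Dd De o c oe).
by have [t' ct' tt'] := closes_since Dd' o'; rewrite (since_uniq c' ct').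
Qed.

(** Since every end of a window is a start, windows can be chained forever. *)
Lemma clock_sequence d : D d -> exists tau : nat -> nat,
  since 0 d (tau 0) /\ forall n, window (tau n) (tau n.+1).
Proof.
move=> Dd; have [t0 t0P] := opens_since Dd.
pose f t := epsilon (inhabits 0) (window t).
exists (fun n => iter n f t0); split=> // n; rewrite [iter n.+1 _ _]/=.
have H t e : D e -> since 0 e t -> window t (f t).
  move=> De o; apply: epsilon_spec; have [t' c' _] := closes_since De o.
  by exists t', e.
elim: n => [|n [e [De _ c]]]; first exact: (H _ d).
have [e' De' ce] := closes_opens De.
by apply: (H _ e') => //; apply: same_since ce c.
Qed.

Variable tau : nat -> nat.
Hypothesis tauP : forall n, window (tau n) (tau n.+1).

Lemma tau_lt m n : m < n -> tau m < tau n.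
Proof.
suff ltS i : tau i < tau i.+1.
  elim: n => // n IH; rewrite ltnS leq_eqVlt => /orP[/eqP->//|/IH h].
  exact: ltn_trans h (ltS n).
have [d [Dd o c]] := tauP i.
by have [t' c' tt'] := closes_since Dd o; rewrite (since_uniq c c').
Qed.

Lemma tau_inj : injective tau.
Proof. by move=> m n e; case: (ltngtP m n) => // /tau_lt; rewrite e ltnn. Qed.

Lemma tau_closes d n : D d -> since 0 d (tau n) -> since 1 d (tau n.+1).
Proof.
move=> Dd o; have [t' c _] := closes_since Dd o.
rewrite (@window_functional (tau n) (tau n.+1) t') //.
by exists d.
Qed.

Definition encodes (c : config) (d : univ A) : Prop :=
  [/\ D d, holds (state_letter c.1) d v &
      forall r, r < k -> since (reg_letter r) d (tau (c.2 r))].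

(** What [Before] says of the fuel times of [d] and [e]. *)
Definition consumes (d e : univ A) : Prop :=
  ~ holds fuel_letter d v ->
  exists u, [/\ v <= u, holds fuel_letter e u & ~ holds fuel_letter d u].

Lemma forces_next_config t s d e :
  forces M v [eta [eta a with 0 |-> d] with 1 |-> e] (next_config b t s) ->
  [/\ holds (state_letter t) e v, b -> consumes d e &
      forall r, r \in s -> same (reg_letter r) d (reg_letter r) e].
Proof.
move=> /forces_conjunction[h hs]; split.
- by case: (b) h => [[]|].
- by move=> hb; move: h; rewrite hb => -[_ /forces_Before].
- by move=> r /hs/forces_Iff.
Qed.

(** The model cannot deviate from the run: the successor of a number is
determined because windows with the same start have the same end, and the
outcome of a test because [tau] is injective. *)
Lemma encodes_step c d :
  forces M v a (rule k b c.1 (prog c.1)) -> c.1 != 0 ->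
  all (gtn k) (registers (prog c.1)) -> encodes c d ->
  exists2 e, encodes (step prog c) e & b -> consumes d e.
Proof.
case: c => q m; rewrite [(q, m).1]/= => hrule q0 kreg [Dd qd md].
rewrite [(q, m).2]/= in md.
rewrite /step [(q, m).1]/= [(q, m).2]/= (negbTE q0).
have {hrule} := hrule v (leqnn v) d Dd v (leqnn v) qd.
case: (prog q) kreg => [i s z t|i j t e] /and3P[ik jk _].
- move=> [/forces_Iff hs [e De [hd /forces_next_config[qe be he]]]].
  have os : since 0 d (tau (m s)) := same_since hs (md _ jk).
  exists e => //; split=> // r rk; rewrite /assign /=; case: eqP => [->|/eqP ri].
    case: z hd => /forces_Iff hd.
      by rewrite addn1; apply: same_since hd (tau_closes Dd os).
    by rewrite addn0; apply: same_since hd _.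
  by apply: same_since (he r _) (md r rk); rewrite mem_filter ri mem_iota.
- have copy t' : (exists2 e, D e &
      forces M v [eta [eta a with 0 |-> d] with 1 |-> e] (next_config b t' (iota 0 k))) ->
      exists2 e, encodes (t', m) e & b -> consumes d e.
    move=> [e' De' /forces_next_config[qe be he]]; exists e' => //; split=> // r rk.
    by apply: same_since (he r _) (md r rk); rewrite mem_iota.
  have ne i' j' : i' < k -> j' < k ->
      forces M v [eta a with 0 |-> d] (Before (reg i' 0) (reg j' 0)) ->
      m i' != m j'.
    move=> ik' jk' /forces_Before h.
    have [vi hi] := md _ ik'; have [vj hj] := md _ jk'.
    have [|u [vu iu ju]] := h.
      by move/(hj v (leqnn v)); rewrite leqNgt vj.
    by apply/eqP => mij; apply: ju; apply/hj => //; rewrite -mij; apply/hi.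
  case=> -[hij he].
  + have -> : m i == m j; last exact: copy.
    move/forces_Iff: hij => hij; apply/eqP/tau_inj.
    exact: since_uniq (same_since hij (md _ ik)) (md _ jk).
  + have /negbTE -> : m i != m j; last exact: copy.
    by case: hij => /ne h; [exact: h | rewrite eq_sym; exact: h].
Qed.

End Soundness.

Lemma forces_rules A (M : model A) v a k b prog n q :
  @forces frame_nat A M v a (rules k b prog n) -> 0 < q <= n ->
  forces M v a (rule k b q (prog q)).
Proof.
elim: n => [|n IH] /=; first by case: q.
move=> [hr hn] /andP[q0]; rewrite leq_eqVlt => /orP[/eqP->//|qn].
by apply: IH => //; rewrite q0.
Qed.

Lemma forces_clock A (M : model A) v a k b prog n :
  @forces frame_nat A M v a (rules k b prog n) -> forces M v a clock.
Proof. by elim: n => [|n IH] //= [_ /IH]. Qed.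

(** The frame is used twice: times exist because its worlds are well ordered and
linearly ordered, and fuel times cannot decrease forever. *)
Lemma machine_formula_valid k b prog n : 0 < n ->
  (forall q, q <= n ->
     all (gtn k) (registers (prog q)) && all (geq n) (targets (prog q))) ->
  (halts prog n <-> ~~ b) -> QSILe frame_nat (machine_formula k b prog n).
Proof.
move=> n0 bounded hb A M w a _ v wv [[d0 Dd0 /forces_conjunction[hq hr]] hrules].
apply: NNPP => not_goal.
have clock_v := forces_clock hrules.
have [tau [tau0 tauP]] := clock_sequence not_goal clock_v Dd0.
have enc0 : encodes M v k tau (run prog n 0) d0.
  split=> // r rk; apply: same_since tau0.
  by apply/same_sym/(@forces_Iff A M v _ _ 0 0)/hr; rewrite mem_iota.
have state_le j : (run prog n j).1 <= n.
  elim: j => //= j IH; rewrite /step; case: eqP => // _.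
  have /andP[_] := bounded _ IH; case: (prog _) => [d s z t|i i' t e] /=.
    by rewrite andbT.
  by move=> /and3P[ht he _]; case: ifP.
have encS j d : encodes M v k tau (run prog n j) d -> (run prog n j).1 != 0 ->
    exists2 e, encodes M v k tau (run prog n j.+1) e & b -> consumes M v d e.
  move=> enc j0; apply: (encodes_step not_goal clock_v tauP _ j0 _ enc).
    by apply: forces_rules hrules _; rewrite lt0n j0 state_le.
  by have /andP[] := bounded _ (state_le j).
have [b0|/negP nb] := boolP b; last first.
  have [j hj] : halts prog n by apply/hb/negP.
  have [d [Dd hd _]] : exists d, encodes M v k tau (run prog n j) d.
    elim: (j) => [|i [d enc]]; first by exists d0.
    have [e|/(encS _ _ enc)[d' enc' _]] := eqVneq (run prog n i).1 0; last by exists d'.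
    by exists d; rewrite /run iterS {1}/step e eqxx.
  apply: (not_goal_letter not_goal Dd); rewrite /goal_letter (negbTE (introN idP nb)).
  by rewrite hj in hd.
have nohalt j : (run prog n j).1 != 0.
  by apply/eqP => e; have := proj1 hb (ex_intro _ j e); rewrite b0.
have not_fuel d : dom v d -> ~ interp M v fuel_letter [:: d].
  by move=> Dd; have := not_goal_letter not_goal Dd; rewrite /goal_letter b0.
(* Induction on a world where the fuel letter is true of the element: the next
   element has this at an earlier world. *)
have none u : forall j d, v <= u -> encodes M v k tau (run prog n j) d ->
    ~ interp M u fuel_letter [:: d].
  elim/ltn_ind: u => u IH j d vu enc hu.
  have [Dd _ _] := enc.
  have [e ence ce] := encS j d enc (nohalt j).
  have [u' [vu' eu' nd]] := ce b0 (not_fuel d Dd).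
  have u'u : u' < u.
    rewrite ltnNge; apply/negP => uu'.
    by apply: nd; apply: (@interp_mono _ _ M u u').
  exact: IH u'u _ _ vu' ence eu'.
have [e ence ce] := encS 0 d0 enc0 (nohalt 0).
have [u [vu eu _]] := ce b0 (not_fuel d0 Dd0).
exact: none vu ence eu.
Qed.

(** * The countermodel of a run *)

Lemma forces_mono (F : frame) (A : aframe F) (M : model A) u w a phi :
  acc u w -> forces M u a phi -> forces M w a phi.
Proof.
elim: phi u w a => /=.
- by [].
- by move=> i xs u w a uw; apply: interp_mono uw _ _.
- by move=> p IHp q IHq u w a uw [/IHp hp /IHq hq]; split; [apply: hp | apply: hq].
- by move=> p IHp q IHq u w a uw [/IHp hp|/IHq hq]; [left; apply: hp | right; apply: hq].
- by move=> p _ q _ u w a uw h v /(acc_trans uw); apply: h.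
- by move=> x p _ u w a uw h v /(acc_trans uw); apply: h.
- move=> x p IH u w a uw [d Dd /IH h]; exists d; last exact: h.
  exact: dom_mono uw _ Dd.
Qed.

Notation nat_aframe := (const_aframe frame_nat (T := nat) (inhabits 0)).

(** With a constant domain, a universal formula need only be checked at the
least world, since truth persists. *)
Lemma forces_All0 (M : model nat_aframe) (a : nat -> nat) x phi :
  (forall d : nat, forces M 0 [eta a with x |-> d] phi) ->
  forces M 0 a (All x phi).
Proof. by move=> h v _ d _; apply: (@forces_mono _ _ M 0 v) => //; apply: h. Qed.

Section Counterexample.
Variables (prog : nat -> instr) (n k N : nat) (b : bool).

(** The element [2 m] encodes the configuration after [m] steps, and the element
[2 m + 1] has the window from [m + 1] to [m + 2], so that every window is
followed by another one.  The value [n] is stored as the time [n + 1]: nothing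
that the goal mentions may be true at the world 0. *)
Definition opening (d : nat) : nat :=
  if odd d then d./2.+1 else
  let c := run prog n d./2 in
  if prog c.1 is Move _ s _ _ then (c.2 s).+1 else 1.

Definition truth (i d w : nat) : bool :=
  match i with
  | 0 => opening d <= w
  | 1 => (opening d).+1 <= w
  | 2 => (if odd d then 1 else (N - d./2).+1) <= w
  | j.+3 =>
      if odd j then ~~ odd d && ((run prog n d./2).1 == j./2)
      else (if odd d then 1 else ((run prog n d./2).2 j./2).+1) <= w
  end.

Lemma truth_mono i d u w : u <= w -> truth i d u -> truth i d w.
Proof.
move=> uw; case: i => [|[|[|i]]] /=; [| | | case: ifP => // _];
  by move=> h; apply: leq_trans uw.
Qed.

Definition counter_interp (w i : nat) (ds : seq nat) : Prop :=
  if ds is [:: d] then truth i d w else False.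

Lemma counter_dom w i ds :
  counter_interp w i ds -> List.Forall (@dom _ nat_aframe w) ds.
Proof. by move=> _; elim: ds => [|d ds IH]; constructor. Qed.

Lemma counter_mono (u w : frame_nat) : acc u w ->
  forall i ds, counter_interp u i ds -> counter_interp w i ds.
Proof. by move=> uw i [|d []] //=; apply: truth_mono. Qed.

Definition counter : model nat_aframe :=
  @Model _ nat_aframe counter_interp counter_dom counter_mono.

Lemma counter_letter i x (a : nat -> nat) w :
  forces counter w a (letter i x) = truth i (a x) w.
Proof. by []. Qed.

Lemma truth_state q d w :
  truth (state_letter q) d w = ~~ odd d && ((run prog n d./2).1 == q).
Proof. by rewrite /state_letter /= odd_double /= uphalf_double. Qed.

Lemma truth_reg r d w :
  truth (reg_letter r) d w =
  ((if odd d then 1 else ((run prog n d./2).2 r).+1) <= w).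
Proof. by rewrite /reg_letter /= odd_double /= doubleK. Qed.

Lemma truth_run r m w :
  truth (reg_letter r) m.*2 w = ((run prog n m).2 r < w).
Proof. by rewrite truth_reg odd_double doubleK. Qed.

Lemma counter_Iff i j x y (a : nat -> nat) w :
  (forall u, truth i (a x) u = truth j (a y) u) ->
  forces counter w a (Iff (letter i x) (letter j y)).
Proof. by move=> h; split=> v _ /=; rewrite h. Qed.

Lemma counter_Before i j x y (a : nat -> nat) w s t :
  (forall u, truth i (a x) u = (s <= u)) ->
  (forall u, truth j (a y) u = (t <= u)) -> s < t ->
  forces counter w a (Before (letter i x) (letter j y)).
Proof.
move=> hi hj st v _ h /=; rewrite hj leqNgt; apply/negP => vt.
have := h (maxn v s) (leq_maxl v s); rewrite /= hi hj => /(_ (leq_maxr v s)).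
by rewrite leqNgt gtn_max vt st.
Qed.

Lemma counter_clock (a : nat -> nat) : forces counter 0 a clock.
Proof.
split; last split.
- by apply: forces_All0 => d; apply: counter_Before (ltnSn (opening d)) => u.
- apply: forces_All0 => d; exists (opening d).*2.+1 => //.
  apply: counter_Iff => u /=.
  by rewrite [in RHS]/opening /= odd_double /= uphalf_double.
- apply: forces_All0 => d; apply: forces_All0 => e.
  case: (leqP (opening e) (opening d)) => h; [left|right] => u _ /= hu.
    exact: leq_trans h hu.
  exact: leq_trans h hu.
Qed.

Hypothesis fuelN : b -> (run prog n N).1 = 0.

(** Fuel times decrease from [N + 1] to 1 along the run, which halts after at
most [N] steps. *)
Lemma counter_next_config (a : nat -> nat) d t s :
  (run prog n d).1 != 0 -> (run prog n d.+1).1 = t ->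
  (forall r, r \in s -> (run prog n d.+1).2 r = (run prog n d).2 r) ->
  forces counter 0 [eta [eta a with 0 |-> d.*2] with 1 |-> d.+1.*2]
    (next_config b t s).
Proof.
move=> d0 dt ds; apply/forces_conjunction; split.
  have ht w : forces counter w
      [eta [eta a with 0 |-> d.*2] with 1 |-> d.+1.*2] (state t 1).
    rewrite /state counter_letter truth_state.
    by rewrite odd_double doubleK dt eqxx.
  case b1: b; last exact: ht.
  split; first exact: ht.
  apply: (counter_Before (s := (N - d.+1).+1) (t := (N - d).+1)) => [u|u|] /=.
  - by rewrite odd_double doubleK.
  - by rewrite odd_double doubleK.
  - suff : d < N by lia.
    rewrite ltnNge; apply/negP => Nd; case/negP: d0; apply/eqP.
    by rewrite /run (iter_halted Nd) // fuelN.
move=> r rs; apply: counter_Iff => u; rewrite !truth_reg /=.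
by rewrite !odd_double !doubleK ds.
Qed.

(** Letters of states hold from the start or never, so an implication with such a
premise need only be checked at the least world. *)
Lemma counter_guard (a : nat -> nat) q phi :
  (~~ odd (a 0) && ((run prog n (a 0)./2).1 == q) -> forces counter 0 a phi) ->
  forces counter 0 a (Imp (state q 0) phi).
Proof.
move=> h v _ hv; apply: (@forces_mono _ _ counter 0 v) (h _) => //.
by rewrite -(truth_state _ _ v); exact: hv.
Qed.

Lemma counter_rule (a : nat -> nat) q :
  0 < q -> forces counter 0 a (rule k b q (prog q)).
Proof.
move=> q0; apply: forces_All0 => d; apply: counter_guard => /andP[dodd /eqP dq].
have dd : d = d./2.*2 by rewrite even_halfK.
rewrite dd; set m := d./2 in dq *.
have m0 : (run prog n m).1 != 0 by rewrite dq -lt0n.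
have mS : run prog n m.+1 = match prog q with
    | Move d s b t => (t, assign d s b (run prog n m).2)
    | Branch i j t e =>
        (if (run prog n m).2 i == (run prog n m).2 j then t else e,
         (run prog n m).2)
    end by rewrite /run iterS {1}/step (negbTE m0) dq.
case pq: (prog q) mS => [i s z t|i j t e] mS.
- have os : opening m.*2 = ((run prog n m).2 s).+1.
    by rewrite /opening odd_double doubleK dq pq.
  split.
    by apply: counter_Iff => u; rewrite truth_reg /= odd_double doubleK os.
  exists m.+1.*2 => //; split.
    have goesto u : truth (reg_letter i) m.+1.*2 u = ((run prog n m).2 s + z < u).
      by rewrite truth_run mS /assign /= eqxx.
    by case: z goesto {pq mS} => goesto; apply: counter_Iff => u;
      rewrite [RHS]goesto /= os ?addn1 ?addn0.
  apply: counter_next_config; rewrite // mS // => r.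
  by rewrite mem_filter /assign /= => /andP[/negbTE ->].
- case: eqP mS => [mij|/eqP mij] mS; [left|right]; split.
  + by apply: counter_Iff => u; rewrite !truth_reg /= odd_double doubleK mij.
  + by exists m.+1.*2 => //; apply: counter_next_config; rewrite ?mS.
  + case: (ltngtP ((run prog n m).2 i) ((run prog n m).2 j)) mij => // lt _;
      [left|right].
      apply: counter_Before
        (_ : ((run prog n m).2 i).+1 < ((run prog n m).2 j).+1) => // u;
        by rewrite truth_reg /= odd_double doubleK.
    apply: counter_Before
      (_ : ((run prog n m).2 j).+1 < ((run prog n m).2 i).+1) => // u;
      by rewrite truth_reg /= odd_double doubleK.
  + by exists m.+1.*2 => //; apply: counter_next_config; rewrite ?mS.
Qed.

Lemma counter_rules (a : nat -> nat) q : forces counter 0 a (rules k b prog q).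
Proof.
elim: q => [|q IH]; first exact: counter_clock.
by split; first exact: counter_rule.
Qed.

Lemma counter_start (a : nat -> nat) : forces counter 0 a (start k n).
Proof.
exists 0 => //; apply/forces_conjunction; split.
  by rewrite /state counter_letter truth_state /= eqxx.
move=> r _; apply: counter_Iff => u; rewrite truth_reg /= /opening /=.
by case: (prog n).
Qed.

Lemma counter_goal (a : nat -> nat) :
  (~~ b -> forall m, (run prog n m).1 != 0) -> ~ forces counter 0 a (goal b).
Proof.
move=> hb [d _ [|]] /=.
  by rewrite /opening; case: ifP => // _; case: (prog _).
rewrite /goal_letter; case: b hb => [_|hb] /=; first by case: ifP.
by rewrite (negbTE (hb isT _)) andbF.
Qed.

End Counterexample.

(** If [b] is true, the run halts and its length gives enough fuel; if [b] is
false, it never reaches the halting state, whose letter is thus never true. *)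
Lemma machine_formula_refuted k (b : bool) prog n :
  (halts prog n <-> b) -> ~ QSIL nat_aframe (machine_formula k b prog n).
Proof.
move=> hb.
have [N hN] : exists N, b -> (run prog n N).1 = 0.
  case: b hb => hb; last by exists 0.
  by have [N hN] := proj2 hb isT; exists N.
move=> /(_ (counter prog n N) 0 (fun=> 0) (fun _ _ => I) 0 (leqnn 0)) h.
apply: (@counter_goal prog n N b (fun=> 0)).
  by move=> nb m; apply/eqP => e; case/negP: nb; apply/hb; exists m.
apply: h; split; first exact: counter_start.
exact: counter_rules.
Qed.

(** * Computability of the formula *)

(** The step of a recursion has more arguments than the function defined, so a
notion for all arities is needed. *)
Definition recursive n (h : n.-tuple nat -> nat) : Prop :=
  exists f : recf n, forall v, eval f v (h v).

Lemma recursive_proj n (i : 'I_n) : recursive (fun v => tnth v i).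
Proof. by exists (RProj i). Qed.

Lemma recursive_comp1 n g (h : n.-tuple nat -> nat) :
  computable1 g -> recursive h -> recursive (fun v => g (h v)).
Proof.
move=> [f fg] [f1 fh]; exists (RComp f (fun=> f1)) => v /=.
by exists [tuple h v] => // i; rewrite ord1.
Qed.

Lemma recursive_comp2 n g (h1 h2 : n.-tuple nat -> nat) :
  computable2 g -> recursive h1 -> recursive h2 ->
  recursive (fun v => g (h1 v) (h2 v)).
Proof.
move=> [f fg] [f1 fh1] [f2 fh2].
exists (RComp f (fun i : 'I_2 => if i == 0 :> nat then f1 else f2)) => v /=.
by exists [tuple h1 v; h2 v] => //; case=> -[|[|]].
Qed.

Lemma computable1_succ : computable1 succn.
Proof. by exists RSucc. Qed.

Lemma recursive_const n c : recursive (fun _ : n.-tuple nat => c).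
Proof.
elim: c => [|c IH]; last exact: recursive_comp1 computable1_succ IH.
exists (RComp RZero (fun i : 'I_0 => False_rect _ (notF (ltn_ord i)))) => v /=.
by exists [tuple] => // -[].
Qed.

Lemma computable1P h :
  recursive (fun v : 1.-tuple nat => h (thead v)) -> computable1 h.
Proof. by move=> [f fh]; exists f => x; have := fh [tuple x]. Qed.

Lemma recursiveP h :
  computable1 h -> recursive (fun v : 1.-tuple nat => h (thead v)).
Proof. by move=> ch; apply: recursive_comp1 ch (recursive_proj _). Qed.

Lemma computable1_const c : computable1 (fun=> c).
Proof. exact/computable1P/recursive_const. Qed.

Lemma computable1_comp1 g h :
  computable1 g -> computable1 h -> computable1 (fun x => g (h x)).
Proof. by move=> cg /recursiveP ch; apply/computable1P/(recursive_comp1 cg). Qed.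

Lemma computable1_comp2 g h1 h2 :
  computable2 g -> computable1 h1 -> computable1 h2 ->
  computable1 (fun x => g (h1 x) (h2 x)).
Proof.
by move=> cg /recursiveP c1 /recursiveP c2; apply/computable1P/(recursive_comp2 cg).
Qed.

Lemma computable1_rec c g (h : nat -> nat) :
  computable2 g -> h 0 = c -> (forall x, h x.+1 = g x (h x)) -> computable1 h.
Proof.
move=> [fg gP] h0 hS; have [fc cP] := @recursive_const 0 c.
exists (RPrec fc fg) => x; apply/eval_prec.
elim: x => [|x IH] /=; first by rewrite h0; apply: cP.
by exists (h x) => //; rewrite hS; apply: gP.
Qed.

Lemma computable2_iter g h :
  computable1 g -> computable1 h -> computable2 (fun n x => iter n g (h x)).
Proof.
move=> cg [f hP].
have [fg gP] := recursive_comp1 cg (@recursive_proj 3 (@Ordinal 3 1 isT)).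
exists (RPrec f fg) => n x; apply/eval_prec.
elim: n => [|n IH] /=; first exact: hP.
by exists (iter n g (h x)) => //; apply: gP.
Qed.

Lemma computable1_double : computable1 double.
Proof.
have c2 : computable2 (fun _ z => z.+2).
  have [f fP] := recursive_comp1 computable1_succ (recursive_comp1 computable1_succ
    (@recursive_proj 2 (@Ordinal 2 1 isT))).
  by exists f => x y; apply: fP.
exact: (computable1_rec c2 (erefl 0.*2)).
Qed.

(** The code of a list is obtained by iterating this function. *)
Lemma computable2_code : computable2 (fun n c => 2 ^ n * c.*2.+1).
Proof.
have [f fP] := computable2_iter computable1_double
  (computable1_comp1 computable1_succ computable1_double).
exists f => n c; suff -> : 2 ^ n * c.*2.+1 = iter n double c.*2.+1 by apply: fP.
elim: n => [|n IH]; first by rewrite mul1n.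
by rewrite iterS -IH expnS -mulnA mul2n.
Qed.

Lemma computable1_code (s : seq (nat -> nat)) :
  List.Forall computable1 s ->
  computable1 (fun x => CodeSeq.code [seq h x | h <- s]).
Proof.
elim: s => [|h s IH] /=; first by move=> _; apply: computable1_const.
move=> hs; inversion hs; apply: (computable1_comp2 computable2_code) => //.
exact: IH.
Qed.

Definition computable_form (F : nat -> form) : Prop :=
  computable1 (fun x => godel (F x)).

Lemma computable_form_const phi : computable_form (fun=> phi).
Proof. exact: computable1_const. Qed.

Lemma computable_And F G : computable_form F -> computable_form G ->
  computable_form (fun x => And (F x) (G x)).
Proof.
move=> cF cG; apply: (@computable1_code [:: fun=> 2; fun x => godel (F x); fun x => godel (G x)]).
by repeat constructor => //; apply: computable1_const.
Qed.

Lemma computable_Imp F G : computable_form F -> computable_form G ->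
  computable_form (fun x => Imp (F x) (G x)).
Proof.
move=> cF cG; apply: (@computable1_code [:: fun=> 4; fun x => godel (F x); fun x => godel (G x)]).
by repeat constructor => //; apply: computable1_const.
Qed.

Lemma computable_All y F : computable_form F -> computable_form (fun x => All y (F x)).
Proof.
move=> cF; apply: (@computable1_code [:: fun=> 5; fun=> y; fun x => godel (F x)]).
by repeat constructor => //; apply: computable1_const.
Qed.

Lemma computable_Ex y F : computable_form F -> computable_form (fun x => Ex y (F x)).
Proof.
move=> cF; apply: (@computable1_code [:: fun=> 6; fun=> y; fun x => godel (F x)]).
by repeat constructor => //; apply: computable1_const.
Qed.

Lemma computable_state h y : computable1 h -> computable_form (fun x => state (h x) y).
Proof.
move=> ch; apply: (@computable1_code [:: fun=> 1; fun x => state_letter (h x); fun=> y]).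
repeat constructor => //; try exact: computable1_const.
do 4!apply: (computable1_comp1 computable1_succ).
exact: computable1_comp1 computable1_double ch.
Qed.

Lemma computable_conjunction F G s :
  computable_form F -> computable_form (fun x => conjunction (F x) G s).
Proof.
move=> cF; elim: s => //= r s IH.
exact: computable_And (computable_form_const _) IH.
Qed.

(** Conjuncts added one by one: the code of the formula is defined by primitive
recursion, because the code of a conjunction depends only on the codes of its
members. *)
Lemma computable_rec F G : computable_form G ->
  (forall x, F x.+1 = And (G x) (F x)) -> computable_form F.
Proof.
move=> cG FS.
have c2 : computable2 (fun x z => CodeSeq.code [:: 2; godel (G x); z]).
  have [f fP] := recursive_comp2 computable2_code (@recursive_const 2 2)
    (recursive_comp2 computable2_code
      (recursive_comp1 cG (recursive_proj ord0))
      (recursive_comp2 computable2_code (recursive_proj (@Ordinal 2 1 isT))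
         (recursive_const 2 0))).
  by exists f => x y; apply: fP.
by apply: (computable1_rec c2 (erefl _)) => x; rewrite FS.
Qed.

Lemma computable_machine_formula k b prog p :
  (forall q, p < q -> prog q = Move 1 1 true q.-1) ->
  computable_form (fun x => machine_formula k b prog (p + x)).
Proof.
move=> progP.
have cp q : computable1 (addn q).
  elim: q => [|q IH]; last exact: computable1_comp1 computable1_succ IH.
  by exists (RProj ord0).
have cst := computable_form_const.
apply: computable_Imp (cst _); apply: computable_And.
  by apply/computable_Ex/computable_conjunction/computable_state.
apply: (@computable_rec _ (fun x => rule k b (p + x).+1 (Move 1 1 true (p + x)))); last first.
  by move=> x; rewrite addnS /= progP // ltnS leq_addr.
apply/computable_All/computable_Imp.
  exact/computable_state/(computable1_comp1 computable1_succ).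
apply: computable_And (cst _) _; apply/computable_Ex.
apply: computable_And (cst _) _; apply/computable_conjunction.
case: b; last exact: computable_state.
by apply: computable_And (cst _); apply: computable_state.
Qed.

Lemma conjunction_bool (P : form -> bool) phi G s :
  (forall f g, P (And f g) = P f && P g) ->
  P (conjunction phi G s) = P phi && all (fun r => P (G r)) s.
Proof.
move=> PA; elim: s => [|r s IH] /=; first by rewrite andbT.
by rewrite PA -/(conjunction phi G s) IH andbCA.
Qed.

Lemma machine_formula_fragment k b prog n :
  in_fragment (machine_formula k b prog n) && positive (machine_formula k b prog n).
Proof.
have cf := @conjunction_bool in_fragment _ _ _ (fun _ _ => erefl).
have cp := @conjunction_bool positive _ _ _ (fun _ _ => erefl).
have nf t s : in_fragment (next_config b t s) by rewrite cf all_predT andbT; case: (b).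
have np t s : positive (next_config b t s) by rewrite cp all_predT andbT; case: (b).
have rf q i : in_fragment (rule k b q i).
  by case: i => [d s [] t|i j t e]; rewrite /= ?nf.
have rp q i : positive (rule k b q i).
  by case: i => [d s [] t|i j t e]; rewrite /= ?np.
have rsf m : in_fragment (rules k b prog m).
  elim: m => // m IH.
  change (is_true (in_fragment (rule k b m.+1 (prog m.+1)) && in_fragment (rules k b prog m))).
  by rewrite rf IH.
have rsp m : positive (rules k b prog m).
  elim: m => // m IH.
  change (is_true (positive (rule k b m.+1 (prog m.+1)) && positive (rules k b prog m))).
  by rewrite rp IH.
by rewrite /= rsf rsp cf cp !all_predT /=; case: (b).
Qed.

(** * Hardness *)

(** The two logics that enclose [L] are not separated by the formula of a
machine: it is valid on all augmented frames, or refuted with a constant domain.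
The machine searches for [y] with [R x y] if [b] is false, and for a
counterexample if [b] is true. *)
Lemma halting_reduction (L : form -> Prop) (R : rel nat) (b : bool) (X : nat -> Prop) :
  (forall phi, QSILe frame_nat phi -> L phi) ->
  (forall phi, L phi -> QSIL nat_aframe phi) ->
  decidable2 R -> (forall x, X x <-> ((exists y, R x y = ~~ b) <-> ~~ b)) ->
  many_one X (godel_numbers (fragment (positive_part L))).
Proof.
move=> hlow hup decR XR.
have [p [k [prog [p0 input bounded haltsP]]]] := search_machine (~~ b) decR.
exists (fun x => godel (machine_formula k b prog (p + x))).
  exact: computable_machine_formula.
move=> x; split=> [/XR hX|[phi [[Lphi _] _] /godel_inj e]].
  have /andP[frag pos] := machine_formula_fragment k b prog (p + x).
  exists (machine_formula k b prog (p + x)) => //; split=> //; split=> //.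
  apply: hlow; apply: machine_formula_valid.
  + by rewrite addn_gt0 p0.
  + by move=> q qn; apply: bounded => //; apply: leq_addr.
  + exact: iff_trans (haltsP x) hX.
apply/XR; rewrite -haltsP; subst phi.
have [//|notb] := classic (halts prog (p + x) <-> ~~ b).
case: (@machine_formula_refuted k b prog (p + x) _ (hup _ Lphi)).
case: (b) notb => /= notb; split=> //.
  by move=> _; apply: NNPP => nh; apply: notb; split.
by move=> h; case: notb.
Qed.

Theorem theorem8p8 (L : form -> Prop)
  (hL : silogic L)
  (hlow : forall phi, QSILe frame_nat phi -> L phi)
  (hup : forall phi, L phi -> QSIL (const_aframe frame_nat (T := nat) (inhabits 0)) phi) :
  Sigma01_hard (fragment (positive_part L)) /\
  Pi01_hard (fragment (positive_part L)).
Proof.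
split=> X [R decR XR]; [apply: (@halting_reduction L R false) => //|
                        apply: (@halting_reduction L R true) => //] => x; rewrite XR /=.
  by split=> [[y ?]|[_ [//|y]]]; [split=> // _; exists y | exists y].
split=> [all_y|none y]; first by split=> // -[y]; rewrite all_y.
by apply/negPn/negP => /negbTE ny; have := proj1 none (ex_intro _ y ny).
Qed.
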